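(* Let $k\ge 1$ be an integer. For every integer $m\ge 0$, the following identity of polynomials in $x$ holds: $$E_m^{(k)}(x+k)=\sum_{n=0}^{m}\widehat{Ch}_n^{(k)}(x)\,S_2(m,n).$$
   Context: Let $p$ be an odd prime. For a continuous function $f$ on $\mathbb{Z}_p$, the fermionic $p$-adic integral is $$\int_{\mathbb{Z}_p} f(x)\,d\mu_{-1}(x)=\lim_{N\to\infty}\sum_{x=0}^{p^N-1}f(x)(-1)^x .$$ The falling factorial is $(y)_n=y(y-1)\cdots(y-n+1)$, with $(y)_0=1$. For an integer $k\ge 1$ and $n\ge 0$, the Changhee polynomials of the second kind with order $k$ are defined by the iterated integral $$\widehat{Ch}_n^{(k)}(x)=\int_{\mathbb{Z}_p}\cdots\int_{\mathbb{Z}_p}(-x_1-\cdots-x_k+x)_n\,d\mu_{-1}(x_1)\cdots d\mu_{-1}(x_k),$$ where the integrand is expanded in powers of $x$ and integrated coefficientwise, giving a polynomial in $\mathbb{Q}_p[x]$. The Stirling numbers of the second kind $S_2(l,n)$ are defined by $(e^t-1)^n=n!\sum_{l=n}^\infty S_2(l,n)\frac{t^l}{l!}$ for $n\ge 0$. The Euler polynomials of order $k$, $E_n^{(k)}(x)\in\mathbb{Q}[x]\subset\mathbb{Q}_p[x]$, are defined by $\left(\frac{2}{e^t+1}\right)^k e^{xt}=\sum_{n=0}^\infty E_n^{(k)}(x)\frac{t^n}{n!}$. *)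

(* Defs.v *)
From HB Require Import structures.
From mathcomp Require Import all_boot all_order all_algebra.
From mathcomp Require Import boolp classical_sets functions filter topology.

Set Implicit Arguments.
Unset Strict Implicit.
Unset Printing Implicit Defensive.

Import GRing.Theory.
Local Open Scope classical_set_scope.
Local Open Scope ring_scope.

Section ClassicalInverse.
Variable R : comNzRingType.

Definition has_inverse : {pred R} := fun x => `[< exists y, y * x = 1 >].

Definition classical_inv (x : R) : R :=
  if pselect (exists y, y * x = 1) is left e then projT1 (cid e) else x.

Lemma classical_mulVx : {in has_inverse, left_inverse 1 classical_inv *%R}.
Proof.
move=> x /asboolP xu; rewrite /classical_inv.
by case: pselect => // e; case: (cid e).
Qed.

Lemma has_inverseP x y : y * x = 1 -> has_inverse x.
Proof. by move=> yx; apply/asboolP; exists y. Qed.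

Lemma classical_inv_out : {in [predC has_inverse], classical_inv =1 id}.
Proof.
move=> x /negP xnu; rewrite /classical_inv.
by case: pselect => // e; case: xnu; apply/asboolP.
Qed.

End ClassicalInverse.

(* Formal power series in one variable t. *)
Record fps (R : Type) := Fps { fps_coef : nat -> R }.

HB.instance Definition _ (R : Type) := gen_eqMixin (fps R).
HB.instance Definition _ (R : Type) := gen_choiceMixin (fps R).

Section FormalPowerSeries.
Variable R : comNzRingType.
Implicit Types f g h : fps R.

Lemma fpsP f g : (forall n, fps_coef f n = fps_coef g n) -> f = g.
Proof. by case: f g => [f] [g] /= /funext ->. Qed.

Definition fps_zero : fps R := Fps (fun=> 0).
Definition fps_one : fps R := Fps (fun n => (n == 0%N)%:R).
Definition fps_opp f := Fps (fun n => - fps_coef f n).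
Definition fps_add f g := Fps (fun n => fps_coef f n + fps_coef g n).
Definition fps_mul f g :=
  Fps (fun n => \sum_(i < n.+1) fps_coef f i * fps_coef g (n - i)%N).

Lemma fps_addA : associative fps_add.
Proof. by move=> f g h; apply/fpsP => n /=; rewrite addrA. Qed.
Lemma fps_addC : commutative fps_add.
Proof. by move=> f g; apply/fpsP => n /=; rewrite addrC. Qed.
Lemma fps_add0 : left_id fps_zero fps_add.
Proof. by move=> f; apply/fpsP => n /=; rewrite add0r. Qed.
Lemma fps_addN : left_inverse fps_zero fps_opp fps_add.
Proof. by move=> f; apply/fpsP => n /=; rewrite addNr. Qed.

HB.instance Definition _ :=
  GRing.isZmodule.Build (fps R) fps_addA fps_addC fps_add0 fps_addN.

Let trunc N f : {poly R} := \poly_(i < N.+1) fps_coef f i.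

Let coef_trunc N f n : (n <= N)%N -> (trunc N f)`_n = fps_coef f n.
Proof. by move=> nN; rewrite coef_poly ltnS nN. Qed.

Let coef_truncM N f g n :
  (n <= N)%N -> (trunc N f * trunc N g)`_n = fps_coef (fps_mul f g) n.
Proof.
move=> nN; rewrite coefM; apply: eq_bigr => i _.
rewrite !coef_trunc ?(leq_trans (leq_subr _ _)) //.
by rewrite (leq_trans _ nN) // -ltnS.
Qed.

Lemma fps_mulC : commutative fps_mul.
Proof.
by move=> f g; apply/fpsP => n; rewrite -!(@coef_truncM n) // mulrC.
Qed.

Lemma fps_mulA : associative fps_mul.
Proof.
move=> f g h; apply/fpsP => n.
transitivity (trunc n f * (trunc n g * trunc n h))`_n.
  rewrite coefM /=; apply: eq_bigr => i _.
  by rewrite coef_truncM ?leq_subr // coef_trunc // -ltnS.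
rewrite mulrA coefM /=; apply: eq_bigr => i _.
by rewrite coef_truncM ?coef_trunc ?leq_subr // -ltnS.
Qed.

Lemma fps_mul1 : left_id fps_one fps_mul.
Proof.
move=> f; apply/fpsP => n /=; rewrite big_ord_recl /= mul1r subn0.
by rewrite big1 ?addr0 // => i _; rewrite mul0r.
Qed.

Lemma fps_mulDl : left_distributive fps_mul fps_add.
Proof.
move=> f g h; apply/fpsP => n /=; rewrite -big_split.
by apply: eq_bigr => i _; rewrite mulrDl.
Qed.

Lemma fps_one_neq0 : fps_one != 0.
Proof.
by apply/eqP => /(congr1 (fun f => fps_coef f 0)) /eqP; rewrite oner_eq0.
Qed.

HB.instance Definition _ := GRing.Zmodule_isComNzRing.Build (fps R)
  fps_mulA fps_mulC fps_mul1 fps_mulDl fps_one_neq0.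
HB.instance Definition _ := GRing.ComNzRing_hasMulInverse.Build (fps R)
  (@classical_mulVx (fps R)) (@has_inverseP (fps R))
  (@classical_inv_out (fps R)).

End FormalPowerSeries.

Section FormalPowerSeriesUnit.
Variables (R : comUnitRingType) (f : fps R).
Hypothesis f0_unit : fps_coef f 0 \is a GRing.unit.

Let invs : nat -> seq R := fix invs n :=
  if n is m.+1 then
    rcons (invs m) ((fps_coef f 0)^-1 *
      ((m == 0%N)%:R - \sum_(i < m) fps_coef f (m - i)%N * (invs m)`_i))
  else [::].

Let size_invs n : size (invs n) = n.
Proof. by elim: n => //= n IHn; rewrite size_rcons IHn. Qed.

Let nth_invs n i : (i < n)%N -> (invs n)`_i = (invs i.+1)`_i.
Proof.
elim: n => // n IHn; rewrite ltnS leq_eqVlt => /predU1P[-> //|lt_in].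
by rewrite [invs n.+1]/= nth_rcons size_invs lt_in IHn.
Qed.

Lemma fps_unit : f \is a GRing.unit.
Proof.
apply/asboolP; exists (Fps (fun n => (invs n.+1)`_n)); apply/fpsP => n /=.
rewrite big_ord_recr /= subnn nth_rcons size_invs ltnn eqxx mulrC mulVKr //.
rewrite addrC -addrA [X in _ + X](_ : _ = 0) ?addr0 //; apply/eqP.
rewrite addrC subr_eq0; apply/eqP/eq_bigr => i _.
by rewrite (nth_invs (ltn_ord i)) mulrC.
Qed.

End FormalPowerSeriesUnit.

(* The series e^(a t). *)
Definition fps_exp (R : comUnitRingType) (a : R) : fps R :=
  Fps (fun n => a ^+ n / n`!%:R).

(* n! times the coefficient of t^n, i.e. the coefficient of t^n / n!. *)
Definition egf_coef (R : comUnitRingType) (f : fps R) (n : nat) : R :=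
  n`!%:R * fps_coef f n.

Definition stirling2 (l n : nat) : rat :=
  egf_coef ((fps_exp (1 : rat) - 1) ^+ n) l / n`!%:R.

Definition euler_poly (k n : nat) : {poly rat} :=
  egf_coef ((2%:R / (fps_exp 1 + 1)) ^+ k * fps_exp 'X) n.

(* The ring Z_p as the inverse limit of the rings Z / p^n: an element is the
   compatible sequence of its residues, each given by its representative in
   [0, p^n). *)
Record padic_int (p : nat) (p_pr : prime p) := PadicInt {
  padic_res : nat -> nat;
  padic_resP : forall n, (padic_res n.+1 %% p ^ n = padic_res n)%N }.

HB.instance Definition _ p (p_pr : prime p) := gen_eqMixin (padic_int p_pr).
HB.instance Definition _ p (p_pr : prime p) := gen_choiceMixin (padic_int p_pr).

Section PadicIntegers.
Variables (p : nat) (p_pr : prime p).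
Local Notation Zp := (padic_int p_pr).
Implicit Types x y z : Zp.

Let res x n := padic_res x n.

Lemma padic_intP x y : (forall n, padic_res x n = padic_res y n) -> x = y.
Proof.
case: x y => [x xP] [y yP] /= /funext xy; subst y.
by rewrite (Prop_irrelevance xP yP).
Qed.

Lemma expp_gt0 n : (0 < p ^ n)%N. Proof. by rewrite expn_gt0 prime_gt0. Qed.

Lemma padic_res_mod x n : (padic_res x n %% p ^ n)%N = padic_res x n.
Proof. by rewrite -(padic_resP x n) modn_mod. Qed.

Lemma padic_res_modD x m n : (padic_res x (m + n) %% p ^ m)%N = padic_res x m.
Proof.
elim: n => [|n IHn]; first by rewrite addn0 padic_res_mod.
rewrite addnS -IHn -(padic_resP x (m + n)) modn_dvdm //.
by rewrite dvdn_exp2l // leq_addr.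
Qed.

Lemma padic_mk_subproof (a : nat -> nat)
    (aP : forall n, a n.+1 = a n %[mod p ^ n]) n :
  ((a n.+1 %% p ^ n.+1) %% p ^ n = a n %% p ^ n)%N.
Proof. by rewrite modn_dvdm ?aP // dvdn_exp2l. Qed.

Definition padic_mk (a : nat -> nat) aP : Zp :=
  PadicInt p_pr (@padic_mk_subproof a aP).

Lemma padic_add_subproof x y n :
  (res x n.+1 + res y n.+1 = res x n + res y n %[mod p ^ n])%N.
Proof. by rewrite -modnDm !padic_resP. Qed.

Lemma padic_mul_subproof x y n :
  (res x n.+1 * res y n.+1 = res x n * res y n %[mod p ^ n])%N.
Proof. by rewrite -modnMm !padic_resP. Qed.

Lemma padic_opp_subproof x n :
  (p ^ n.+1 - res x n.+1 = p ^ n - res x n %[mod p ^ n])%N.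
Proof.
have le_res m : (res x m <= p ^ m)%N.
  by rewrite /res -padic_res_mod ltnW // ltn_mod expp_gt0.
apply/eqP; rewrite -(eqn_modDr (res x n.+1)) subnK //.
rewrite expnS modnMl -modnDmr /res padic_resP -/(res x n) subnK //.
by rewrite modnn.
Qed.

Definition padic_zero : Zp := padic_mk (fun=> erefl (0 %% _)%N).
Definition padic_one : Zp := padic_mk (fun=> erefl (1 %% _)%N).
Definition padic_opp x : Zp := padic_mk (padic_opp_subproof x).
Definition padic_add x y : Zp := padic_mk (padic_add_subproof x y).
Definition padic_mul x y : Zp := padic_mk (padic_mul_subproof x y).

Lemma padic_addA : associative padic_add.
Proof.
by move=> x y z; apply/padic_intP => n /=; rewrite modnDml modnDmr addnA.
Qed.
Lemma padic_addC : commutative padic_add.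
Proof. by move=> x y; apply/padic_intP => n /=; rewrite addnC. Qed.
Lemma padic_add0 : left_id padic_zero padic_add.
Proof.
by move=> x; apply/padic_intP => n /=; rewrite modnDml add0n padic_res_mod.
Qed.
Lemma padic_addN : left_inverse padic_zero padic_opp padic_add.
Proof.
move=> x; apply/padic_intP => n /=; rewrite modnDml subnK ?modnn ?mod0n //.
by rewrite /res -padic_res_mod ltnW // ltn_mod expp_gt0.
Qed.

HB.instance Definition _ := GRing.isZmodule.Build Zp
  padic_addA padic_addC padic_add0 padic_addN.

Lemma padic_mulA : associative padic_mul.
Proof.
by move=> x y z; apply/padic_intP => n /=; rewrite modnMml modnMmr mulnA.
Qed.
Lemma padic_mulC : commutative padic_mul.
Proof. by move=> x y; apply/padic_intP => n /=; rewrite mulnC. Qed.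
Lemma padic_mul1 : left_id padic_one padic_mul.
Proof.
by move=> x; apply/padic_intP => n /=; rewrite modnMml mul1n padic_res_mod.
Qed.
Lemma padic_mulDl : left_distributive padic_mul padic_add.
Proof.
move=> x y z; apply/padic_intP => n /=.
by rewrite modnMml modnDml modnDmr mulnDl.
Qed.
Lemma padic_one_neq0 : padic_one != 0.
Proof.
apply/eqP => /(congr1 (fun x => padic_res x 1)) /=.
by rewrite expn1 mod0n modn_small ?prime_gt1.
Qed.

HB.instance Definition _ := GRing.Zmodule_isComNzRing.Build Zp
  padic_mulA padic_mulC padic_mul1 padic_mulDl padic_one_neq0.
HB.instance Definition _ := GRing.ComNzRing_hasMulInverse.Build Zp
  (@classical_mulVx Zp) (@has_inverseP Zp) (@classical_inv_out Zp).

Lemma padic_neq0 x : x != 0 -> exists n, padic_res x n != 0%N.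
Proof.
move=> /eqP x0; apply: contrapT => /forallNP xn; apply: x0.
by apply/padic_intP => n /=; rewrite mod0n; apply/eqP/negPn/negP/xn.
Qed.

Lemma padic_integral : GRing.integral_domain_axiom Zp.
Proof.
move=> x y xy0; apply/norP => -[/padic_neq0[m xm] /padic_neq0[n yn]].
have := congr1 (fun z => padic_res z (m + n)) xy0; rewrite /= mod0n /res.
move=> /eqP; rewrite -/(dvdn _ _); apply/negP.
have xmn := padic_res_modD x m n.
have ymn := padic_res_modD y n m; rewrite addnC in ymn.
set a := padic_res x _ in xmn *; set b := padic_res y _ in ymn *.
have a_ndvd : ~~ (p ^ m %| a)%N by rewrite /dvdn xmn.
have b_ndvd : ~~ (p ^ n %| b)%N by rewrite /dvdn ymn.
have a_gt0 : (0 < a)%N by case: (a) a_ndvd; rewrite ?dvdn0.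
have b_gt0 : (0 < b)%N by case: (b) b_ndvd; rewrite ?dvdn0.
move: a_ndvd b_ndvd; rewrite !pfactor_dvdn ?muln_gt0 ?a_gt0 // lognM //.
rewrite -!ltnNge => am bn.
by rewrite -addnS leq_add // ltnW.
Qed.

HB.instance Definition _ := GRing.ComUnitRing_isIntegral.Build Zp
  padic_integral.

End PadicIntegers.

Definition padic (p : nat) (p_pr : prime p) := {fraction (padic_int p_pr)}.

HB.instance Definition _ p (p_pr : prime p) := GRing.Field.on (padic p_pr).
HB.instance Definition _ p (p_pr : prime p) :=
  isPointed.Build (padic p_pr) 0.

Definition padic_of_int p (p_pr : prime p) (z : padic_int p_pr) : padic p_pr :=
  tofrac z.

(* The p-adic topology: the sets x + p^n Z_p form a basis of neighborhoods
   of x. *)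
Definition padic_nbhs p (p_pr : prime p) (x : padic p_pr)
    : set (set (padic p_pr)) :=
  [set A | exists n : nat, forall z : padic_int p_pr,
     A (x + padic_of_int (p%:R ^+ n * z))].

HB.instance Definition _ p (p_pr : prime p) :=
  hasNbhs.Build (padic p_pr) (@padic_nbhs p p_pr).

Section PadicTopology.
Variables (p : nat) (p_pr : prime p).
Local Notation Qp := (padic p_pr).

Lemma padic_nbhs_filter (x : Qp) : ProperFilter (nbhs x).
Proof.
split; first by case=> n /(_ 0).
split; first by exists 0%N.
- move=> A B [m Am] [n Bn]; exists (m + n)%N => z; split.
    by rewrite exprD -mulrA; exact: Am.
  by rewrite addnC exprD -mulrA; exact: Bn.
- by move=> A B AB [n An]; exists n => z; exact: AB.
Qed.

Lemma padic_nbhs_singleton (x : Qp) (A : set Qp) : nbhs x A -> A x.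
Proof.
by case=> n /(_ 0); rewrite mulr0 /padic_of_int rmorph0 addr0.
Qed.

Lemma padic_nbhs_nbhs (x : Qp) (A : set Qp) : nbhs x A -> nbhs x (nbhs^~ A).
Proof.
case=> n An; exists n => y; exists n => z.
by rewrite -addrA /padic_of_int -rmorphD -mulrDr; exact: An.
Qed.

HB.instance Definition _ := Nbhs_isNbhsTopological.Build Qp
  padic_nbhs_filter padic_nbhs_singleton padic_nbhs_nbhs.

Lemma padic_hausdorff : hausdorff_space Qp.
Proof.
move=> x y xy.
have near n : exists z : padic_int p_pr,
    x - y = padic_of_int (p%:R ^+ n * z).
  have ballx (w : Qp) : nbhs w
      [set w + padic_of_int (p%:R ^+ n * z) | z in [set: padic_int p_pr]].
    by exists n => z; exists z.
  have [_ [[z1 _ <-] [z2 _ e]]] := xy _ _ (ballx x) (ballx y).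
  exists (z2 - z1); move: e; rewrite /padic_of_int mulrBr rmorphB => e.
  by apply/eqP; rewrite subr_eq addrC addrA e addrK.
have [a xya] := near 0%N; rewrite expr0 mul1r in xya.
apply/eqP; rewrite -subr_eq0 xya /padic_of_int tofrac_eq0; apply/eqP.
apply: padic_intP => n /=; rewrite mod0n.
have [z] := near n; rewrite xya => /eqP; rewrite /padic_of_int tofrac_eq => /eqP ->.
have resX m : padic_res (p%:R ^+ m : padic_int p_pr) n = (p ^ m %% p ^ n)%N.
  have res1 k : padic_res (k%:R : padic_int p_pr) n = (k %% p ^ n)%N.
    elim: k => [|k IHk] //; rewrite -addn1 natrD /= IHk.
    by rewrite modnDml modnDmr.
  by rewrite -natrX res1.
by rewrite /= resX modnn mul0n mod0n.
Qed.

End PadicTopology.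

Section Changhee.
Variables (p : nat) (p_pr : prime p).
Local Notation Zp := (padic_int p_pr).
Local Notation Qp := (padic p_pr).

(* Total in f; equal to 0 when the limit does not exist, which does not happen
   for continuous f and odd p. *)
Definition fermionic_integral (f : Zp -> Qp) : Qp :=
  lim ((fun N : nat => \sum_(x < p ^ N) f x%:R * (-1) ^+ x) @ \oo).

(* The innermost integral is over the first variable, the outermost one over
   the last. *)
Fixpoint fermionic_iterated_integral (k : nat) : (k.-tuple Zp -> Qp) -> Qp :=
  match k with
  | 0%N => fun f => f [tuple]
  | k'.+1 => fun f => fermionic_integral (fun x =>
      fermionic_iterated_integral (fun t : k'.-tuple Zp => f [tuple of rcons t x]))
  end.

Definition falling (R : nzRingType) (y : R) (n : nat) : R :=
  \prod_(i < n) (y - i%:R).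

(* The integrand is a polynomial in 'X of degree n, so that the coefficients of
   'X^i for i <= n are all of its coefficients. *)
Definition changhee2 (k n : nat) : {poly Qp} :=
  \poly_(i < n.+1) fermionic_iterated_integral (fun xs : k.-tuple Zp =>
    (falling (- (\sum_(j < k) padic_of_int (tnth xs j))%:P + 'X) n)`_i).

End Changhee.

(* Main.v *)
(* Let D Q = Q(X) + Q(X - 1).  On polynomials over a domain in which 2 <> 0 this
   operator preserves degrees, hence is injective, so it suffices to compare the
   images of both sides under D^k.
   - The partial sums of the fermionic integral of y |-> (D U)(X - y) telescope
     to U(X) + U(X - p^N), which tends to 2 U(X) coefficientwise.  As p is odd,
     2 is a unit of Z_p and D is onto Z_p[X], so the k-fold integral of G(X - y)
     is the W with D^k W = 2^k G, and D^k maps the n-th Changhee polynomial to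
     2^k (X)_n.  Working over Z_p keeps the error terms in p^N Z_p.
   - The generating function gives E^(k+1)(X + 1) + E^(k+1)(X) = 2 E^(k)(X),
     so that D^k maps E_m^(k)(X + k) to 2^k X^m.
   - Reading t^m in e^(a t) = (1 + (e^t - 1))^a for all naturals a yields
     X^m = sum_n S_2(m, n) (X)_n, and the two images agree. *)
From HB Require Import structures.
Require Import Defs.
From mathcomp Require Import all_boot all_order all_algebra.
From mathcomp Require Import boolp classical_sets functions filter topology.
From mathcomp Require Import ring zify.

Set Implicit Arguments.
Unset Strict Implicit.
Unset Printing Implicit Defensive.

Import GRing.Theory.
Local Open Scope ring_scope.

(** * The embedding of the rationals in a field of characteristic 0 *)

Section CharZeroRatr.
Variable F : fieldType.

(* The proof of characteristic 0 is an argument so that canonical instances can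
   depend on it. *)
Definition char0_ratr of (forall n : nat, n.+1%:R != 0 :> F) : rat -> F := ratr.

Hypothesis F0 : forall n : nat, n.+1%:R != 0 :> F.

Let intr_neq0 (z : int) : z != 0 -> z%:~R != 0 :> F.
Proof.
case: z => [[|n] //|n] _; first exact: F0.
by rewrite NegzE mulrNz oppr_eq0; exact: F0.
Qed.

(** [ratr] uses the reduced fraction of x, whereas sums and products come with the unreduced
    denominator [denq x * denq y]; hence any fraction equal to x is allowed here. *)
Let ratr_eq (x : rat) (c z : int) :
  c != 0 -> x * c%:~R = z%:~R -> (ratr x : F) = z%:~R / c%:~R.
Proof.
move=> c0 xc; have d0 := intr_neq0 (denq_neq0 x).
apply/eqP; rewrite /ratr eqr_div ?intr_neq0 // -!intrM; apply/eqP; congr _%:~R.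
apply/(@intr_inj rat); rewrite !intrM -xc numqE mulrAC //.
Qed.

Lemma char0_ratr_is_zmod_morphism : zmod_morphism (char0_ratr F0).
Proof.
move=> x y; have dx := intr_neq0 (denq_neq0 x).
have dy := intr_neq0 (denq_neq0 y).
rewrite /char0_ratr (@ratr_eq (x - y) (denq x * denq y)
    (numq x * denq y - numq y * denq x)).
- by rewrite intrB !intrM /ratr -[in RHS]mulNr addf_div // mulNr.
- by rewrite mulf_neq0 ?denq_neq0.
- by rewrite intrB !intrM !numqE; ring.
Qed.

Lemma char0_ratr_is_monoid_morphism : monoid_morphism (char0_ratr F0).
Proof.
split=> [|x y]; first exact: (ratr_nat F 1).
rewrite /char0_ratr (@ratr_eq (x * y) (denq x * denq y) (numq x * numq y)).
- by rewrite /ratr mulf_div !intrM.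
- by rewrite mulf_neq0 ?denq_neq0.
- by rewrite !intrM !numqE mulrACA.
Qed.

HB.instance Definition _ := GRing.isZmodMorphism.Build rat F (char0_ratr F0)
  char0_ratr_is_zmod_morphism.
HB.instance Definition _ := GRing.isMonoidMorphism.Build rat F (char0_ratr F0)
  char0_ratr_is_monoid_morphism.

End CharZeroRatr.

(** * Formal power series: coefficients, change of ring, exponentials *)

Section Fps.
Variable R : comNzRingType.
Implicit Types f g : fps R.

Lemma fps_coefM f g n :
  fps_coef (f * g) n = \sum_(i < n.+1) fps_coef f i * fps_coef g (n - i)%N.
Proof. by []. Qed.

Lemma fps_coefD f g n : fps_coef (f + g) n = fps_coef f n + fps_coef g n.
Proof. by []. Qed.

Lemma fps_coef_sum (I : Type) (r : seq I) (P : pred I) (F : I -> fps R) n :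
  fps_coef (\sum_(i <- r | P i) F i) n = \sum_(i <- r | P i) fps_coef (F i) n.
Proof. exact: (big_morph (fun f => fps_coef f n)). Qed.

Lemma fps_coefMn f c n : fps_coef (f *+ c) n = fps_coef f n *+ c.
Proof. by elim: c => // c IHc; rewrite !mulrS fps_coefD IHc. Qed.

(** As f is a multiple of t, its n-th power is a multiple of t^n. *)
Lemma fps_coef_expr_lt f n m :
  fps_coef f 0 = 0 -> (m < n)%N -> fps_coef (f ^+ n) m = 0.
Proof.
move=> f0; elim: n m => // n IHn m ltmn; rewrite exprS fps_coefM.
apply: big1 => -[[|i] ltim] _ /=; first by rewrite f0 mul0r.
by rewrite IHn ?mulr0 //; lia.
Qed.

End Fps.

Section FpsMap.
Variables (R S : comNzRingType) (phi : {rmorphism R -> S}).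

Definition fps_map (f : fps R) : fps S := Fps (fun n => phi (fps_coef f n)).

Lemma fps_map_is_zmod_morphism : zmod_morphism fps_map.
Proof. by move=> f g; apply/fpsP => n /=; rewrite rmorphB. Qed.

Lemma fps_map_is_monoid_morphism : monoid_morphism fps_map.
Proof.
split=> [|f g]; apply/fpsP => n /=; first by rewrite rmorph_nat.
by rewrite rmorph_sum; apply: eq_bigr => i _; rewrite rmorphM.
Qed.

HB.instance Definition _ := GRing.isZmodMorphism.Build (fps R) (fps S) fps_map
  fps_map_is_zmod_morphism.
HB.instance Definition _ := GRing.isMonoidMorphism.Build (fps R) (fps S) fps_map
  fps_map_is_monoid_morphism.

End FpsMap.

Section FpsExp.
Variable R : comUnitRingType.
Hypothesis fact_unit : forall n, n`!%:R \is a @GRing.unit R.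

Lemma fps_expD (a b : R) : fps_exp (a + b) = fps_exp a * fps_exp b.
Proof.
apply/fpsP => n; rewrite fps_coefM /= addrC exprDn mulr_suml.
apply: eq_bigr => i _; have lein : (i <= n)%N by rewrite -ltnS.
have binV : 'C(n, i)%:R / n`!%:R = i`!%:R^-1 / (n - i)`!%:R :> R.
  apply: (mulIr (fact_unit n)); rewrite divrK // -invrM // -(bin_fact lein).
  rewrite natrM [(i`! * _)%N]mulnC natrM mulrCA.
  by rewrite mulVr ?unitrM ?fact_unit ?mulr1.
by rewrite mulrACA -binV -mulr_natr mulrA [b ^+ _ * _]mulrC.
Qed.

Lemma fps_exp0 : fps_exp (0 : R) = 1.
Proof.
by apply/fpsP => -[|n] /=; rewrite ?expr0 ?divr1 // expr0n /= mul0r.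
Qed.

Lemma fps_exp_natr n : fps_exp (n%:R : R) = fps_exp 1 ^+ n.
Proof.
elim: n => [|n IHn]; first by rewrite fps_exp0.
by rewrite -addn1 natrD fps_expD IHn addn1 exprSr.
Qed.

End FpsExp.

(** * The operator D *)

Section ShiftSum.
Variable R : comNzRingType.
Implicit Types P Q : {poly R}.

Definition shift_sum P := P + (P \Po ('X - 1)).

Lemma shift_sum_is_linear : linear shift_sum.
Proof.
move=> a P Q; rewrite /shift_sum comp_polyD comp_polyZ scalerDr.
by rewrite addrACA.
Qed.
HB.instance Definition _ := GRing.isLinear.Build R {poly R} {poly R} _
  shift_sum shift_sum_is_linear.

Lemma shift_sum_comp P c :
  shift_sum (P \Po ('X - c%:P)) = shift_sum P \Po ('X - c%:P).
Proof.
rewrite /shift_sum comp_polyD; congr (_ + _); rewrite -!comp_polyA.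
by congr (_ \Po _); rewrite !comp_polyB !comp_polyX !comp_polyC addrAC.
Qed.

Lemma iter_shift_sumZ k a P :
  iter k shift_sum (a *: P) = a *: iter k shift_sum P.
Proof. by elim: k => //= k ->; rewrite linearZ. Qed.

Lemma iter_shift_sumB k P Q :
  iter k shift_sum (P - Q) = iter k shift_sum P - iter k shift_sum Q.
Proof. by elim: k => //= k ->; rewrite linearB. Qed.

Lemma iter_shift_sum_sum k (I : Type) (r : seq I) (F : I -> {poly R}) :
  iter k shift_sum (\sum_(i <- r) F i) = \sum_(i <- r) iter k shift_sum (F i).
Proof. by elim: k => //= k ->; rewrite linear_sum. Qed.

Lemma iter_shift_sum_comp k P c :
  iter k shift_sum (P \Po ('X - c%:P)) = iter k shift_sum P \Po ('X - c%:P).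
Proof. by elim: k => //= k ->; rewrite shift_sum_comp. Qed.

(** What matters is that Q has coefficients in R: for R = Z_p and c = p^N it puts the error term of
    the integral in p^N Z_p. *)
Lemma comp_poly_XsubC_mod (P : {poly R}) (c : R) :
  exists Q, P \Po ('X - c%:P) = P + c *: Q.
Proof.
elim/poly_ind: P => [|P a [Q QE]].
  by exists 0; rewrite comp_poly0 scaler0 addr0.
exists (Q * ('X - c%:P) - P); rewrite comp_poly_MXaddC QE.
by rewrite -!mul_polyC; ring.
Qed.

End ShiftSum.

Lemma map_iter_shift_sum (R S : comNzRingType) (f : {rmorphism R -> S}) k P :
  map_poly f (iter k (@shift_sum R) P) = iter k (@shift_sum S) (map_poly f P).
Proof.
elim: k => //= k <-; rewrite rmorphD /= map_comp_poly rmorphB /= map_polyX.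
by rewrite rmorph1.
Qed.

Section ShiftSumSize.
Variable R : idomainType.
Hypothesis two_neq0 : 2%:R != 0 :> R.

(** P and its translate have the same leading coefficient, which doubles in the sum and so does not
    cancel. *)
Lemma size_shift_sum (P : {poly R}) : size (shift_sum P) = size P.
Proof.
have [->|P0] := eqVneq P 0; first by rewrite linear0.
have szX1 : size ('X - 1 : {poly R}) = 2 by rewrite size_XsubC.
have szP1 : size (P \Po ('X - 1)) = size P by rewrite size_comp_poly2.
apply/eqP; rewrite eqn_leq; apply/andP; split.
  by apply: leq_trans (size_polyD _ _) _; rewrite szP1 maxnn.
rewrite -[X in (X <= _)%N]prednK ?size_poly_gt0 //.
rewrite ltnNge; apply/negP => /leq_sizeP/(_ _ (leqnn _))/eqP; apply/negP.
rewrite coefD -{2}szP1 -!lead_coefE lead_coef_comp ?szX1 //.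
rewrite lead_coefXsubC expr1n mulr1 -mulr2n -mulr_natl.
by rewrite mulf_neq0 ?lead_coef_eq0.
Qed.

Lemma size_iter_shift_sum k (P : {poly R}) :
  size (iter k (@shift_sum R) P) = size P.
Proof. by elim: k => //= k <-; rewrite size_shift_sum. Qed.

End ShiftSumSize.

Section ShiftSumOnto.
Variable R : comUnitRingType.
Hypothesis two_unit : 2%:R \is a @GRing.unit R.

Lemma shift_sum_onto (P : {poly R}) : exists Q, shift_sum Q = P.
Proof.
have onto_sum n (F : 'I_n -> {poly R}) :
    (forall i, exists Q, shift_sum Q = F i) ->
    exists Q, shift_sum Q = \sum_i F i.
  move=> QF; have [Q QE] := boolp.choice QF; exists (\sum_i Q i).
  by rewrite linear_sum; apply: eq_bigr => i _; exact: QE.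
have ontoZ a F : (exists Q, shift_sum Q = F) -> exists Q, shift_sum Q = a *: F.
  by case=> Q <-; exists (a *: Q); rewrite linearZ.
suff ontoX n : exists Q, shift_sum Q = 'X^n :> {poly R}.
  rewrite -[P]coefK poly_def; apply: onto_sum => i; exact: ontoZ.
elim/ltn_ind: n => n IHn.
(* D X^n - 2 X^n has degree below n, so induction provides a preimage Q; then D(X^n - Q) = 2 X^n. *)
have [Q QE] : exists Q, shift_sum Q = shift_sum 'X^n - 2%:R *: 'X^n :> {poly R}.
  have -> : shift_sum 'X^n - 2%:R *: 'X^n =
      \sum_(i < n) (((-1) ^+ (n - i)) *+ 'C(n, i)) *: 'X^i :> {poly R}.
    rewrite /shift_sum rmorphXn /= comp_polyX [_ - 1]addrC exprDn.
    rewrite big_ord_recr /= subnn expr0 mul1r binn mulr1n [_ + 'X^n]addrC.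
    rewrite addrA -mulr2n scaler_nat [X in X - _]addrC addrK; apply: eq_bigr => i _.
    by rewrite -scalerMnl -mul_polyC rmorphXn rmorphN1.
  by apply: (onto_sum n) => i; apply: ontoZ; exact: IHn.
exists (2%:R^-1 *: ('X^n - Q)); rewrite linearZ linearB /= QE opprB addrC subrK.
by rewrite scalerA mulVr ?scale1r.
Qed.

Lemma iter_shift_sum_onto k (P : {poly R}) :
  exists Q, iter k (@shift_sum R) Q = P.
Proof.
elim: k => [|k [Q <-]]; first by exists P.
by have [Q' <-] := shift_sum_onto Q; exists Q'; rewrite iterSr.
Qed.

End ShiftSumOnto.

(** * Falling factorials and Stirling numbers *)

Lemma falling_map (R S : nzRingType) (f : {rmorphism R -> S}) (y : R) n :
  f (falling y n) = falling (f y) n.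
Proof.
by rewrite rmorph_prod; apply: eq_bigr => i _; rewrite rmorphB rmorph_nat.
Qed.

Lemma falling_natr (R : nzRingType) (a n : nat) :
  falling (a%:R : R) n = (a ^_ n)%:R.
Proof.
elim: n => [|n IHn]; first by rewrite /falling big_ord0.
rewrite /falling big_ord_recr /= -/(falling _ n) IHn ffactnSr natrM.
(* For a < n the truncated difference a - n is wrong in R, but the preceding factor [a ^_ n] is
   already 0. *)
have [lena|ltan] := leqP n a; first by rewrite natrB.
by rewrite ffact_small // mulr0n !mul0r.
Qed.

Lemma size_falling (R : idomainType) n :
  size (falling ('X : {poly R}) n) = n.+1.
Proof.
rewrite /falling (eq_bigr (fun i : 'I_n => 'X - (i%:R)%:P)) => [|i _]; last first.
  by rewrite rmorph_nat.
by rewrite -big_enum size_prod_XsubC size_enum_ord.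
Qed.

Lemma rat_fact_unit n : n`!%:R \is a @GRing.unit rat.
Proof. by rewrite unitfE Num.Theory.pnatr_eq0 -lt0n fact_gt0. Qed.

(** The difference P of the two sides vanishes at the naturals a < [size P], too many roots for a
    nonzero polynomial. At a, both sides are m! times the coefficient of t^m in e^(a t). *)
Lemma exprX_stirling2 m :
  'X^m = \sum_(n < m.+1) falling ('X : {poly rat}) n * (stirling2 m n)%:P.
Proof.
apply/eqP; rewrite -subr_eq0; set P := (X in X == 0).
apply: contraT => P0; have : all (root P) [seq a%:R | a <- iota 0 (size P)].
  apply/allP => _ /mapP[a _ ->]; rewrite rootE /P hornerD hornerN hornerXn.
  rewrite horner_sum subr_eq0; apply/eqP.
  transitivity (m`!%:R * fps_coef (fps_exp (a%:R : rat)) m).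
    by rewrite /= mulrC divrK // rat_fact_unit.
  rewrite fps_exp_natr; last exact: rat_fact_unit.
  rewrite -[fps_exp 1](subrK 1) addrC exprDn fps_coef_sum mulr_sumr.
  pose F i := m`!%:R * fps_coef ((fps_exp (1 : rat) - 1) ^+ i *+ 'C(a, i)) m.
  (* The binomial theorem sums over i <= a, the claim over i <= m. Both sums extend to i <= a + m:
     'C(a, i) = 0 for i > a, and (e^t - 1)^i has no t^m term for i > m. *)
  have trunc b : (b <= a + m)%N -> (forall i, (b < i)%N -> F i = 0) ->
      \sum_(i < b.+1) F i = \sum_(i < (a + m).+1) F i.
    move=> leb F0.
    rewrite (big_ord_widen_cond _ predT F (_ : b < (a + m).+1)%N) // big_mkcond; apply: eq_bigr => i _; case: ltnP => // ltbi.
    by rewrite F0.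
  transitivity (\sum_(i < a.+1) F i).
    by apply: eq_bigr => i _; rewrite expr1n mul1r.
  rewrite trunc ?leq_addr //; last first.
    by move=> i ltai; rewrite /F bin_small // mulr0n mulr0.
  rewrite -(trunc m) ?leq_addl //; last first.
    move=> i ltmi; by rewrite /F fps_coefMn fps_coef_expr_lt ?mul0rn ?mulr0.
  apply: eq_bigr => n _; rewrite hornerM hornerC.
  have -> : (falling 'X n).[a%:R] = falling (a%:R : rat) n.
    by rewrite -[LHS]/(horner_eval _ _) falling_map /= /horner_eval hornerX.
  rewrite falling_natr -bin_ffact natrM /stirling2 /egf_coef /F fps_coefMn.
  rewrite -[_ *+ 'C(a, n)]mulr_natl.
  by rewrite -[RHS]mulrA [n`!%:R * _]mulrC divrK ?rat_fact_unit // mulrCA.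
move/(max_poly_roots P0); rewrite map_inj_uniq; last first.
  by move=> x y /eqP; rewrite Num.Theory.eqr_nat => /eqP.
by rewrite iota_uniq size_map size_iota ltnn => /(_ isT).
Qed.

(** * Euler polynomials *)

Lemma polyrat_natr_unit n : n.+1%:R \is a @GRing.unit {poly rat}.
Proof.
rewrite -(rmorph_nat (@polyC rat)).
by rewrite rmorph_unit // unitfE Num.Theory.pnatr_eq0.
Qed.

Lemma polyrat_fact_unit n : n`!%:R \is a @GRing.unit {poly rat}.
Proof. by rewrite -[n`!]prednK ?fact_gt0 ?polyrat_natr_unit. Qed.

(** Named to carry the ring morphism structure with which [fps_map] applies it coefficientwise. *)
Definition translate (P : {poly rat}) : {poly rat} := P \Po ('X + 1).
HB.instance Definition _ := GRing.RMorphism.copy translate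
  (fun P : {poly rat} => P \Po ('X + 1)).

(** The constant term is 2. Hence the division in [euler_poly] is a true one, not the default value
    of the inverse. *)
Lemma euler_gf_unit : fps_exp (1 : {poly rat}) + 1 \is a GRing.unit.
Proof.
apply: fps_unit; rewrite -[fps_coef _ 0]/(1 ^+ 0 / 0`!%:R + 1%:R).
by rewrite expr0 divr1 -[1 + 1%:R]/(2%:R) polyrat_natr_unit.
Qed.

Lemma fps_map_exp (a : {poly rat}) :
  fps_map translate (fps_exp a) = fps_exp (translate a).
Proof.
apply/fpsP => n /=; rewrite rmorphM rmorphXn rmorphV ?polyrat_fact_unit //=.
by rewrite rmorph_nat.
Qed.

Lemma fps_map_egf_coef f n :
  egf_coef (fps_map translate f) n = translate (egf_coef f n).
Proof. by rewrite /egf_coef /= rmorphM rmorph_nat. Qed.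

(** The shift turns e^(X t) into e^(X t) e^t; the sum gains the factor e^t + 1, which one factor h
    turns into 2. *)
Lemma euler_polyS k m :
  translate (euler_poly k.+1 m) + euler_poly k.+1 m = 2%:R * euler_poly k m.
Proof.
set h : fps {poly rat} := 2%:R / (fps_exp 1 + 1).
have hE : h * (fps_exp 1 + 1) = 2%:R by rewrite divrK ?euler_gf_unit.
(* h does not involve X: it is determined by h (e^t + 1) = 2, an equation fixed by the shift. *)
have h_const : fps_map translate h = h.
  apply: (mulIr euler_gf_unit); rewrite hE.
  have {1}-> : fps_exp 1 + 1 = fps_map translate (fps_exp (1 : {poly rat}) + 1).
    by rewrite rmorphD rmorph1 /= fps_map_exp rmorph1.
  by rewrite -rmorphM hE rmorph_nat.
rewrite -fps_map_egf_coef rmorphM rmorphXn /= h_const fps_map_exp.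
rewrite [translate 'X]comp_polyX fps_expD; last exact: polyrat_fact_unit.
rewrite /egf_coef -mulrDr -fps_coefD.
have -> : h ^+ k.+1 * (fps_exp 'X * fps_exp 1) + h ^+ k.+1 * fps_exp 'X =
    h ^+ k * fps_exp 'X *+ 2.
  transitivity (h ^+ k * (h * (fps_exp 1 + 1)) * fps_exp 'X).
    by rewrite exprS; ring.
  by rewrite hE -mulr_natl; ring.
by rewrite fps_coefMn mulrnAr mulr_natl.
Qed.

Lemma euler_poly0 m : euler_poly 0 m = 'X^m.
Proof.
rewrite /euler_poly expr0 mul1r /egf_coef /= mulrC divrK //.
exact: polyrat_fact_unit.
Qed.

Lemma comp_poly_XaddC (R : comNzRingType) (P : {poly R}) (a b : R) :
  (P \Po ('X + a%:P)) \Po ('X + b%:P) = P \Po ('X + (a + b)%:P).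
Proof.
rewrite -comp_polyA comp_polyD comp_polyX comp_polyC -addrA.
by rewrite -polyCD [b + a]addrC.
Qed.

Lemma iter_shift_sum_euler k m :
  iter k (@shift_sum rat) (euler_poly k m \Po ('X + k%:R%:P)) =
  2%:R ^+ k *: 'X^m.
Proof.
elim: k => [|k IHk]; first by rewrite /= addr0 comp_polyXr euler_poly0 scale1r.
rewrite iterSr.
(* The two terms of D are the values at X + k + 1 and X + k, so [euler_polyS] applies, translated by
   k. *)
have -> : shift_sum (euler_poly k.+1 m \Po ('X + k.+1%:R%:P)) =
    2%:R *: (euler_poly k m \Po ('X + k%:R%:P)).
  rewrite /shift_sum -[-1](rmorphN1 (@polyC rat)) comp_poly_XaddC -addn1.
  rewrite natrD addrK addrC [k%:R + 1]addrC -comp_poly_XaddC -comp_polyD addrC addn1.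
  rewrite polyC1 -/(translate _) [X in X \Po _]addrC euler_polyS [_ + 'X]addrC.
  by rewrite mulr_natl -scaler_nat comp_polyZ.
by rewrite iter_shift_sumZ IHk scalerA -exprS.
Qed.

(** * Fermionic integrals over Z_p and Changhee polynomials *)

Section Padic.
Variables (p : nat) (p_pr : prime p).
Local Notation Zp := (padic_int p_pr).
Local Notation Qp := (padic p_pr).

HB.instance Definition _ :=
  GRing.RMorphism.copy (@padic_of_int p p_pr : Zp -> Qp) (@tofrac Zp).

Lemma padic_res_natr a n : padic_res (a%:R : Zp) n = (a %% p ^ n)%N.
Proof.
elim: a => [//|a IHa]; rewrite -addn1 natrD /= IHa.
by rewrite modnDml modnDmr.
Qed.

Lemma padic_natr_neq0 n : n.+1%:R != 0 :> Qp.
Proof.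
rewrite -(rmorph_nat (@padic_of_int p p_pr)) /padic_of_int tofrac_eq0.
(* As n + 1 < p^(n+1), this residue of n + 1 is n + 1 itself. *)
apply/eqP => /(congr1 (fun x => padic_res x n.+1)).
rewrite padic_res_natr /= mod0n modn_small //.
exact: ltn_expl (prime_gt1 p_pr).
Qed.

Hypothesis p_odd : odd p.

(** The inverse has residues (p^n + 1)/2, integers because p is odd; consecutive ones differ by p^n
    (p - 1)/2. *)
Lemma padic_two_unit : 2%:R \is a @GRing.unit Zp.
Proof.
have halfP n : ((p ^ n).+1./2 * 2 = (p ^ n).+1)%N.
  by rewrite muln2 -[RHS]odd_double_half /= oddX p_odd orbT.
have half_mod n : ((p ^ n.+1).+1./2 = (p ^ n).+1./2 %[mod p ^ n])%N.
  have -> : ((p ^ n.+1).+1./2 = p./2 * p ^ n + (p ^ n).+1./2)%N.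
    apply/eqP; rewrite -(@eqn_pmul2r 2) //; apply/eqP.
    rewrite mulnDl !halfP expnS.
    have pE : (p = p./2 * 2 + 1)%N.
      by rewrite muln2 -{1}[p]odd_double_half p_odd addnC.
    by rewrite {1}pE; ring.
  by rewrite modnMDl.
apply/asboolP; exists (padic_mk p_pr half_mod); rewrite mulr_natr mulr2n.
apply: padic_intP => n /=.
by rewrite modnDm addnn -muln2 halfP -addn1 modnDl.
Qed.

Lemma fermionic_integral_shift_sum (U : {poly Zp}) i :
  fermionic_integral
    (fun x => padic_of_int ((shift_sum U \Po ('X - x%:P))`_i)) =
  padic_of_int (2%:R * U`_i).
Proof.
have partial N : \sum_(x < p ^ N)
    padic_of_int ((shift_sum U \Po ('X - (x%:R : Zp)%:P))`_i) * (-1) ^+ x =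
    padic_of_int (U`_i + (U \Po ('X - (p%:R ^+ N : Zp)%:P))`_i).
  (* Induction needs an arbitrary bound a; for a = p^N, which is odd, the sign becomes a plus. *)
  have telescope a : \sum_(x < a)
      padic_of_int ((shift_sum U \Po ('X - (x%:R : Zp)%:P))`_i) * (-1) ^+ x =
      padic_of_int (U`_i - (-1) ^+ a * (U \Po ('X - (a%:R : Zp)%:P))`_i).
    elim: a => [|a IHa].
      by rewrite big_ord0 subr0 comp_polyXr mul1r subrr rmorph0.
    rewrite big_ord_recr /= IHa.
    have -> : shift_sum U \Po ('X - (a%:R : Zp)%:P) =
        (U \Po ('X - a%:R%:P)) + (U \Po ('X - a.+1%:R%:P)).
      rewrite /shift_sum comp_polyD; congr (_ + _); rewrite -comp_polyA.
      congr (_ \Po _); rewrite comp_polyB comp_polyX -polyC1 comp_polyC.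
      by rewrite -addrA -opprD -polyCD -mulrSr.
    rewrite -(rmorphN1 (@padic_of_int p p_pr)) -rmorphXn -rmorphM -rmorphD.
    by congr padic_of_int; rewrite coefD exprS; ring.
  by rewrite telescope -signr_odd oddX p_odd orbT natrX mulN1r opprK.
rewrite /fermionic_integral (eq_fun partial).
apply: cvg_lim; first exact: padic_hausdorff.
move=> A [n An]; exists n => // N /= leqnN.
have [Q ->] := comp_poly_XsubC_mod U (p%:R ^+ N).
(* For N >= n the error p^N Q_i equals p^n times this element of Z_p, so the partial sum lies in the
   given neighborhood. *)
have := An (p%:R ^+ (N - n) * Q`_i).
rewrite mulrA -exprD subnKC // -rmorphD coefD coefZ.
by rewrite addrA -mulr2n mulr_natl.
Qed.

(** G and W vary in the induction: with the outer variable x fixed, the inner integral is that of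
    G(X - x), and D commutes with translations. *)
Lemma fermionic_iterated_integral_poly k (G W : {poly Zp}) i :
  iter k (@shift_sum Zp) W = 2%:R ^+ k *: G ->
  fermionic_iterated_integral (fun t : k.-tuple Zp =>
    padic_of_int ((G \Po ('X - (\sum_(j < k) tnth t j)%:P))`_i)) =
  padic_of_int W`_i.
Proof.
elim: k G W => [|k IHk] G W.
  by rewrite /= scale1r big_ord0 subr0 comp_polyXr => ->.
(* The inner k-fold integral yields W'(X - x). Since W' = D(W/2), integrating over x gives 2 (W/2) =
   W. *)
set W' := shift_sum (2%:R^-1 *: W) => WG.
have W'G : iter k (@shift_sum Zp) W' = 2%:R ^+ k *: G.
  rewrite /W' -iterSr iter_shift_sumZ WG scalerA exprS mulKr //.
  exact: padic_two_unit.
transitivity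
    (fermionic_integral (fun x => padic_of_int ((W' \Po ('X - x%:P))`_i))).
  rewrite /=; congr fermionic_integral; apply/funext => x.
  rewrite -(IHk (G \Po ('X - x%:P))); last first.
    by rewrite iter_shift_sum_comp W'G comp_polyZ.
  congr fermionic_iterated_integral; apply/funext => t.
  rewrite -!(big_tuple _ _ _ predT id) /= big_rcons /= -comp_polyA.
  congr (padic_of_int (_ \Po _)`_i).
  by rewrite comp_polyB comp_polyX comp_polyC polyCD; ring.
rewrite fermionic_integral_shift_sum coefZ mulVKr //; exact: padic_two_unit.
Qed.

Lemma iter_shift_sum_changhee2 k n :
  iter k (@shift_sum Qp) (changhee2 p_pr k n) = 2%:R ^+ k *: falling 'X n.
Proof.
have [W WE] := iter_shift_sum_onto padic_two_unit k (2%:R ^+ k *: falling 'X n).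
suff -> : changhee2 p_pr k n = map_poly (@padic_of_int p p_pr) W.
  rewrite -map_iter_shift_sum WE linearZ /= falling_map /= map_polyX.
  by rewrite rmorphXn rmorph_nat.
have two_neq0 : 2%:R != 0 :> Zp.
  by apply: contraTneq padic_two_unit => ->; rewrite unitr0.
(* [changhee2] keeps only the coefficients up to X^n, so those of W beyond n must vanish. *)
have szW : size W = n.+1.
  rewrite -(size_iter_shift_sum two_neq0 k) WE size_scale ?expf_neq0 //.
  exact: size_falling.
apply/polyP => i; rewrite coef_poly coef_map.
case: ltnP => [_|ltni]; last by rewrite nth_default ?rmorph0 ?szW.
apply: etrans (fermionic_iterated_integral_poly i WE).
congr fermionic_iterated_integral; apply/funext => t.
rewrite -coef_map map_comp_poly falling_map rmorphB /= map_polyX map_polyC.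
rewrite -[falling 'X n \Po _]/(comp_poly _ (falling 'X n)) falling_map /=.
by rewrite comp_polyX [_ + 'X]addrC !rmorph_sum.
Qed.

End Padic.

Theorem theorem2p9 (p : nat) (p_pr : prime p) (p_odd : odd p)
    (k : nat) (k_ge1 : (1 <= k)%N) (m : nat) :
  (map_poly ratr (euler_poly k m) : {poly (padic p_pr)}) \Po ('X + k%:R%:P) =
  \sum_(n < m.+1) changhee2 p_pr k n * (ratr (stirling2 m n))%:P.
Proof.
(* f is [ratr] itself, now with a ring morphism structure. *)
pose f : {rmorphism rat -> padic p_pr} := char0_ratr (padic_natr_neq0 p_pr).
rewrite -[ratr]/(f : rat -> padic p_pr).
apply/eqP; rewrite -subr_eq0 -size_poly_eq0.
(* Injectivity of D^k: it preserves the size of the difference, as 2 is nonzero in Q_p. *)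
rewrite -(size_iter_shift_sum (padic_natr_neq0 p_pr 1) k) size_poly_eq0.
rewrite iter_shift_sumB subr_eq0; apply/eqP.
have -> : map_poly f (euler_poly k m) \Po ('X + k%:R%:P) =
    map_poly f (euler_poly k m \Po ('X + k%:R%:P)).
  by rewrite map_comp_poly rmorphD /= map_polyX !rmorph_nat.
rewrite -map_iter_shift_sum iter_shift_sum_euler linearZ /= exprX_stirling2.
rewrite rmorphXn rmorph_nat iter_shift_sum_sum rmorph_sum scaler_sumr.
apply: eq_bigr => n _.
rewrite [RHS](_ : _ = f (stirling2 m n) *: (2%:R ^+ k *: falling 'X n)).
  rewrite rmorphM /= map_polyC falling_map /= map_polyX [_ * _%:P]mulrC.
  by rewrite mul_polyC !scalerA mulrC.
by rewrite mulrC mul_polyC iter_shift_sumZ iter_shift_sum_changhee2.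
Qed.
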